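(* Let $N\ge 2$, let $\mathcal{K}\subseteq\mathbb{Z}_N$ be an $(N,K,\lambda)$ difference set, let $v=\frac{1}{\sqrt{K}}\chi_{\mathcal{K}}\in\mathbb{C}^N$, and for $i=0,\dots,N-1$ let $\mathcal{W}_i=\operatorname{span}\{M_jT_iv\}_{j=0}^{N-1}\subseteq\mathbb{C}^N$. Then the Gabor fusion frame $\{\mathcal{W}_i\}_{i=0}^{N-1}$ associated to $\mathcal{K}$ is an equidistant fusion frame with $$d_c^2(\mathcal{W}_{i_1},\mathcal{W}_{i_2})=\frac{K(N-K)}{N-1}\qquad\text{for all } i_1\neq i_2 .$$
   Context: $\mathbb{Z}_N=\{0,1,\dots,N-1\}$ with arithmetic modulo $N$; vectors in $\mathbb{C}^N$ are indexed by $\mathbb{Z}_N$, and all index operations are modulo $N$. Difference set: a nonempty subset $\mathcal{K}=\{u_1,\dots,u_K\}\subseteq\mathbb{Z}_N$ with $K$ elements is an $(N,K,\lambda)$ difference set if the $K(K-1)$ differences $(u_k-u_l)\bmod N$, $k\ne l$, take all nonzero values $1,2,\dots,N-1$, each exactly $\lambda$ times. $\chi_{\mathcal{K}}\in\mathbb{C}^N$ is the characteristic function of $\mathcal{K}$: $\chi_{\mathcal{K}}(j)=1$ if $j\in\mathcal{K}$ and $0$ otherwise. Modulation and translation operators on $\mathbb{C}^N$: $(M_jg)(n)=e^{2\pi i jn/N}g(n)$ and $(T_kg)(n)=g(n-k)$ for $n=0,\dots,N-1$. The subspace $\mathcal{W}_i$ is also described as the space of all $x\in\mathbb{C}^N$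 with $\operatorname{supp}(x)\subseteq\mathcal{K}+i$. A family of subspaces $\{\mathcal{W}_i\}$ of $\mathbb{C}^N$ is a fusion frame (all weights equal to one) if there exist $0<A\le B<\infty$ with $A\|x\|_2^2\le\sum_i\|P_ix\|_2^2\le B\|x\|_2^2$ for all $x\in\mathbb{C}^N$, where $P_i$ is the orthogonal projection onto $\mathcal{W}_i$. Chordal distance: for subspaces $\mathcal{W}_1,\mathcal{W}_2$ of $\mathbb{C}^N$ of the same dimension $m$, with orthogonal projections $P_1,P_2$, the chordal distance $d_c(\mathcal{W}_1,\mathcal{W}_2)\ge 0$ is given by $d_c^2(\mathcal{W}_1,\mathcal{W}_2)=m-\operatorname{Tr}[P_1P_2]$. A family of subspaces of equal dimension is equidistant if all pairwise chordal distances are equal. *)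

(* Defs.v *)
From mathcomp Require Export all_boot all_order all_algebra.
From mathcomp Require Export complex.
From mathcomp Require Export reals trigo.

Set Implicit Arguments.
Unset Strict Implicit.
Unset Printing Implicit Defensive.

Import Order.TTheory GRing.Theory Num.Theory.

Local Open Scope ring_scope.

(* Vectors of C^N are row vectors over R[i] indexed by 'Z_N. As 'Z_N is
   'I_(Zp_trunc N).+2, it is Z/NZ only for 1 < N; the index type of a row
   vector has to be spelled (Zp_trunc N).+2.

   A subspace is the row space of a matrix; a linear operator acts on vectors
   on the right, x |-> x *m P. *)

(* lam = 0 is allowed: it occurs exactly when S is a singleton. *)
Definition is_difference_set (N K lam : nat) (S : {set 'Z_N}) : Prop :=
  [/\ S != set0, #|S| = K &
      forall d : 'Z_N, d != 0 ->
        #|[set p : 'Z_N * 'Z_N |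
            [&& p.1 \in S, p.2 \in S, p.1 != p.2 & p.1 - p.2 == d]]| = lam].

Section Gabor.
Variables (R : realType) (N : nat).
Local Notation C := R[i].
Local Notation vec := 'rV[C]_((Zp_trunc N).+2).

Definition expi (t : R) : C := (cos t +i* sin t)%C.

Definition modulation (j : 'Z_N) (g : vec) : vec :=
  \row_n (expi (2 * pi * j%:R * n%:R / N%:R) * g 0 n).

Definition translation (k : 'Z_N) (g : vec) : vec := \row_n g 0 (n - k).

Definition charvec (S : {set 'Z_N}) : vec := \row_j (j \in S)%:R.

Definition window (S : {set 'Z_N}) : vec := (sqrtC #|S|%:R)^-1 *: charvec S.

(* The rows are the spanning vectors M_j T_i v, so that the row space is
   their span. *)
Definition gabor_subspace (S : {set 'Z_N}) (i : 'Z_N) :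
    'M[C]_((Zp_trunc N).+2) :=
  \matrix_j modulation j (translation i (window S)).

End Gabor.

Section FusionFrame.
Variables (R : realType) (n : nat).
Local Notation C := R[i].

(* dotmx x x is the squared l2 norm of x, and proj_ortho W is the matrix of
   the orthogonal projection onto the row space of W. *)
Definition is_fusion_frame (I : finType) (W : I -> 'M[C]_n) : Prop :=
  exists A B : R, [/\ 0 < A, A <= B &
    forall x : 'rV[C]_n,
      A%:C%C * dotmx x x
        <= \sum_i dotmx (x *m proj_ortho (W i)) (x *m proj_ortho (W i))
        <= B%:C%C * dotmx x x].

(* Only meaningful when \rank W1 = \rank W2. *)
Definition chordal_dist (W1 W2 : 'M[C]_n) : C :=
  sqrtC ((\rank W1)%:R - \tr (proj_ortho W1 *m proj_ortho W2)).

Definition is_equidistant (I : finType) (W : I -> 'M[C]_n) : Prop :=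
  (forall i j, \rank (W i) = \rank (W j)) /\
  (forall i j k l, i != j -> k != l ->
     chordal_dist (W i) (W j) = chordal_dist (W k) (W l)).

End FusionFrame.

(* Main.v *)
Require Import Defs.
From mathcomp Require Import lra ring.

Set Implicit Arguments.
Unset Strict Implicit.
Unset Printing Implicit Defensive.

Import Order.TTheory GRing.Theory Num.Theory.

Local Open Scope ring_scope.
Local Open Scope sesquilinear_scope.

(** The vector [T_i v] is a nonzero constant times the indicator of [S + i],
    and its modulations are the rows of the Fourier matrix times the diagonal
    matrix of [T_i v].  The Fourier matrix is a Vandermonde matrix with
    distinct nodes, hence invertible, so the span [W_i] is the coordinate
    subspace supported on [S + i] ([gabor_subspace_coord]) and its orthogonal
    projection [P_i] is the diagonal 0/1 matrix of [S + i]
    ([proj_gabor_subspace]).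

    Everything else is counting.  Each coordinate [n] lies in exactly [K] of
    the translates [S + i], so the sum of the [|x P_i|^2] is [K |x|^2]: the
    frame is tight, with both bounds equal to [K] ([gabor_tight_frame]).
    The trace of [P_i1 P_i2] is the cardinal of
    [(S + i1) :&: (S + i2)]; a point [n] of this set is the same thing as a
    pair [(n - i1, n - i2)] of elements of [S] with difference [i2 - i1], so
    for [i1 != i2] the trace is [lam], and
    [d_c^2 = K - lam] ([gabor_chordal_dist], [card_translateI]).
    Finally, sorting the [K^2] pairs of elements of [S] by their difference
    gives [K + (N - 1) lam = K^2] ([difference_count]), which turns [K - lam]
    into [K (N - K) / (N - 1)]. *)

(** * Idempotent matrices and orthogonal projections *)

(** In a full-rank factorization [P = B *m C], idempotence cancels to
    [C *m B = 1], and the trace is cyclic. *)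
Lemma mxtrace_idempotent (F : fieldType) (n : nat) (P : 'M[F]_n) :
  P *m P = P -> \tr P = (\rank P)%:R.
Proof.
move=> idP; have BC1 : row_base P *m col_base P = 1%:M.
  apply: (row_full_inj (col_base_full P)).
  apply: (row_free_inj (row_base_free P)).
  by rewrite mulmx1 mulmxA mulmx_base -mulmxA mulmx_base.
by rewrite -{1}(mulmx_base P) mxtrace_mulC BC1 mxtrace1.
Qed.

(** The projection onto [W] fixes the rows of [P] and kills those of [1 - P],
    which are orthogonal to [W] because [P] is hermitian and idempotent. *)
Lemma proj_ortho_unique (C : numClosedFieldType) (m n : nat)
    (W : 'M[C]_(m, n)) (P : 'M[C]_n) :
  P *m P = P -> P ^t* = P -> (W :=: P)%MS -> proj_ortho W = P.
Proof.
move=> idP hP WP; rewrite -[LHS]mul1mx -(subrK P 1%:M) mulmxDl.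
rewrite (@proj_ortho_id _ _ _ _ _ P) ?WP // proj_ortho_0 ?add0r //.
rewrite (eqmx_ortho _ WP); apply/orthomx1P.
by rewrite hP mulmxBl mul1mx idP subrr.
Qed.

(** * Coordinate projections *)

Section CoordinateProjection.
Variables (C : numClosedFieldType) (n : nat).

Definition coord_proj (T : {set 'I_n}) : 'M[C]_n :=
  diag_mx (\row_j (j \in T)%:R).

Lemma coord_projM (T U : {set 'I_n}) :
  coord_proj T *m coord_proj U = coord_proj (T :&: U).
Proof.
rewrite mulmx_diag; congr diag_mx; apply/rowP => j.
by rewrite !mxE inE -natrM mulnb.
Qed.

Lemma coord_proj_herm (T : {set 'I_n}) : (coord_proj T) ^t* = coord_proj T.
Proof.
rewrite tr_diag_mx map_diag_mx; congr diag_mx; apply/rowP => j.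
by rewrite !mxE rmorph_nat.
Qed.

Lemma mxtrace_coord_proj (T : {set 'I_n}) : \tr (coord_proj T) = #|T|%:R.
Proof.
rewrite mxtrace_diag -sum1_card natr_sum [RHS]big_mkcond /=.
by apply: eq_bigr => j _; rewrite mxE; case: (j \in T).
Qed.

Lemma dotmx_coord_proj (T : {set 'I_n}) (x : 'rV[C]_n) :
  dotmx (x *m coord_proj T) (x *m coord_proj T)
  = \sum_j `|x 0 j| ^+ 2 * (j \in T)%:R.
Proof.
rewrite dotmxE mxE; apply: eq_bigr => j _.
rewrite mul_mx_diag !mxE rmorphM /= rmorph_nat normCK.
by case: (j \in T); rewrite ?mulr1 ?mulr0.
Qed.

Lemma proj_ortho_coord (W : 'M[C]_n) (T : {set 'I_n}) :
  (W :=: coord_proj T)%MS -> proj_ortho W = coord_proj T.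
Proof.
by apply: proj_ortho_unique; rewrite ?coord_proj_herm // coord_projM setIid.
Qed.

Lemma rank_coord_proj (T : {set 'I_n}) : \rank (coord_proj T) = #|T|.
Proof.
apply: (mulrIn (oner_neq0 C)).
by rewrite -mxtrace_idempotent ?mxtrace_coord_proj // coord_projM setIid.
Qed.

End CoordinateProjection.

(** * Injectivity of the exponential on a period *)

Section Characters.
Variable R : realType.

Lemma expi_natM (x : R) (k : nat) : expi (k%:R * x) = expi x ^+ k.
Proof.
elim: k => [|k IH]; first by rewrite mul0r /expi cos0 sin0.
rewrite exprS -IH -natr1 mulrDl mul1r addrC /expi cosD sinD.
by congr (_ +i* _)%C; ring.
Qed.

(** If the values agreed then [cos (y - x) = 1], that is,
    [sin ((y - x) / 2) = 0], although [(y - x) / 2] lies strictly between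
    [0] and [pi]. *)
Lemma expi_neq (x y : R) : 0 < y - x < 2 * pi -> expi x != expi y.
Proof.
move=> /andP[d0 d2]; apply/eqP => -[ecos esin].
pose h := (y - x) / 2.
have dE : y - x = h *+ 2 by rewrite /h; lra.
have /sin_gt0_pi/(exprn_gt0 2) : 0 < h < pi by rewrite /h; lra.
have : cos (y - x) = 1 by rewrite cosB ecos esin -!expr2 cos2Dsin2.
rewrite dE cos_mulr2n cos2sin2; lra.
Qed.

End Characters.

(** * Translates and difference sets in a finite abelian group *)

Section DifferenceSets.
Variable V : finZmodType.
Implicit Types S : {set V}.

Definition translate S (i : V) : {set V} := [set n | n - i \in S].

Lemma card_translate S i : #|translate S i| = #|S|.
Proof.
rewrite -(card_imset S (addIr i)); apply: eq_card => n.
apply/idP/imsetP => [|[m mS ->]]; last by rewrite inE addrK.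
by rewrite inE => nS; exists (n - i); rewrite ?subrK.
Qed.

Lemma card_translates_through S n : #|[set i | n \in translate S i]| = #|S|.
Proof.
rewrite -(card_imset S (@subrI V n)); apply: eq_card => i.
apply/idP/imsetP => [|[m mS ->]]; last by rewrite !inE subKr.
by rewrite !inE => nS; exists (n - i); rewrite ?subKr.
Qed.

(** The diagonal pairs are kept (they all have difference [0]), so that
    these sets partition the square of [S] when [d] ranges over the group. *)
Definition difference_pairs S (d : V) : {set V * V} :=
  [set p | [&& p.1 \in S, p.2 \in S & p.1 - p.2 == d]].

(** A common point [n] of the translates by [i1] and [i2] is determined by
    the pair [(n - i1, n - i2)] of elements of [S], whose difference is
    [i2 - i1]. *)
Lemma card_translateI S i1 i2 :
  #|translate S i1 :&: translate S i2| = #|difference_pairs S (i2 - i1)|.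
Proof.
have finj : injective (fun n : V => (n - i1, n - i2)) by move=> m n [/addIr].
rewrite -(card_imset _ finj); apply: eq_card => -[a b].
rewrite !inE /=; apply/imsetP/and3P => [[n]|[aS bS /eqP abE]].
  rewrite !inE => /andP[nS1 nS2] [-> ->]; split=> //.
  by rewrite opprB addrC addrA subrK.
have bE : b = a + i1 - i2 by rewrite -addrA -opprB -abE subKr.
by exists (a + i1); rewrite ?inE ?addrK -?bE // aS.
Qed.

Lemma sum_card_difference_pairs S :
  (\sum_d #|difference_pairs S d| = #|S| ^ 2)%N.
Proof.
rewrite -mulnn -cardsX -sum1_card (partition_big (fun p => p.1 - p.2) predT) //=.
apply: eq_bigr => d _; rewrite sum1dep_card; apply: eq_card => p.
by rewrite !inE andbA.
Qed.

Lemma card_difference_pairs0 S : #|difference_pairs S 0| = #|S|.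
Proof.
by rewrite -(subrr 0) -card_translateI setIid card_translate.
Qed.

(** The [#|S| ^ 2] pairs of elements of [S] split according to their
    difference: [#|S|] of them have difference [0], and each of the other
    [#|V| - 1] differences occurs [lam] times. *)
Lemma difference_count S lam :
  (forall d, d != 0 -> #|difference_pairs S d| = lam) ->
  (#|S| + (#|V| - 1) * lam = #|S| ^ 2)%N.
Proof.
move=> cardS; rewrite -sum_card_difference_pairs (bigD1 0) //=.
rewrite card_difference_pairs0 (eq_bigr (fun=> lam)) // sum_nat_const.
by rewrite cardC1 subn1.
Qed.

End DifferenceSets.

(** * The Gabor subspaces of a set *)

Section GaborSubspaces.
Variables (R : realType) (N : nat) (S : {set 'Z_N}).
Hypotheses (N_ge2 : (2 <= N)%N) (S_neq0 : S != set0).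

Let N_gt0 : 0 < N%:R :> R.
Proof. by rewrite ltr0n ltnW. Qed.

Definition fourier_nodes : 'rV[R[i]]_(Zp_trunc N).+2 :=
  \row_n expi (2 * pi * n%:R / N%:R).

(** The Vandermonde determinant is the product of the differences of the
    nodes, and the [N]-th roots of unity are pairwise distinct. *)
Lemma fourier_unitmx : Vandermonde (Zp_trunc N).+2 fourier_nodes \in unitmx.
Proof.
rewrite unitmxE det_Vandermonde unitfE; apply/prodf_neq0 => i _.
apply/prodf_neq0 => j lt_ij; rewrite !mxE subr_eq0 eq_sym; apply: expi_neq.
have jN : (j < N)%N by rewrite -[ltnRHS](Zp_cast N_ge2).
rewrite -mulrBl -mulrBr !mulr_gt0 ?invr_gt0 ?pi_gt0 ?subr_gt0 ?ltr_nat //=.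
rewrite -mulrA gtr_pMr ?mulr_gt0 ?pi_gt0 // ltr_pdivrMr // mul1r.
by rewrite -(natrB _ (ltnW lt_ij)) ltr_nat (leq_ltn_trans (leq_subr _ _)).
Qed.

(** Modulation multiplies pointwise by a character, so the matrix of all
    modulations of a vector is the Fourier matrix times the diagonal matrix of
    that vector. *)
Lemma gabor_subspace_factor i :
  gabor_subspace R S i = Vandermonde (Zp_trunc N).+2 fourier_nodes
    *m ((sqrtC #|S|%:R)^-1 *: coord_proj R[i] (translate S i)).
Proof.
apply/matrixP => j n; rewrite -scalemxAr mul_mx_diag !mxE inE -expi_natM.
by rewrite mulrCA; congr (expi _ * _); ring.
Qed.

(** Left multiplication by an invertible matrix and scaling by a nonzero
    constant preserve the row space. *)
Lemma gabor_subspace_coord i :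
  (gabor_subspace R S i :=: coord_proj R[i] (translate S i))%MS.
Proof.
rewrite gabor_subspace_factor.
apply: eqmx_trans (eqmxMfull _ _) (eqmx_scale _ _).
  by rewrite row_full_unit fourier_unitmx.
by rewrite invr_eq0 sqrtC_eq0 pnatr_eq0 cards_eq0.
Qed.

Lemma proj_gabor_subspace i :
  proj_ortho (gabor_subspace R S i) = coord_proj R[i] (translate S i).
Proof. exact/proj_ortho_coord/gabor_subspace_coord. Qed.

Lemma rank_gabor_subspace i : \rank (gabor_subspace R S i) = #|S|.
Proof.
by rewrite gabor_subspace_coord rank_coord_proj card_translate.
Qed.

(** After exchanging the sums, the coordinate [j] of [x] contributes
    [|x_j|^2] once for each translate of [S] that contains [j], and there are
    [#|S|] of these. *)
Lemma gabor_tight_frame (x : 'rV[R[i]]_(Zp_trunc N).+2) :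
  \sum_i dotmx (x *m proj_ortho (gabor_subspace R S i))
               (x *m proj_ortho (gabor_subspace R S i))
  = #|S|%:R * dotmx x x.
Proof.
under eq_bigr => i _ do rewrite proj_gabor_subspace dotmx_coord_proj.
rewrite exchange_big /= dotmxE mxE mulr_sumr; apply: eq_bigr => j _.
rewrite -mulr_sumr !mxE -normCK mulrC; congr (_ * _).
rewrite -(card_translates_through S j) -sum1_card natr_sum [RHS]big_mkcond /=.
by apply: eq_bigr => i _; rewrite !inE; case: (_ \in S).
Qed.

Lemma gabor_chordal_dist i1 i2 :
  chordal_dist (gabor_subspace R S i1) (gabor_subspace R S i2)
  = sqrtC (#|S|%:R - #|difference_pairs S (i2 - i1)|%:R).
Proof.
rewrite /chordal_dist rank_gabor_subspace !proj_gabor_subspace coord_projM.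
by rewrite mxtrace_coord_proj card_translateI.
Qed.

End GaborSubspaces.

Theorem theorem3p5 (R : realType) (N K lam : nat) (S : {set 'Z_N}) :
  (2 <= N)%N ->
  is_difference_set K lam S ->
  [/\ is_fusion_frame (gabor_subspace R S),
      is_equidistant (gabor_subspace R S) &
      forall i1 i2 : 'Z_N, i1 != i2 ->
        chordal_dist (gabor_subspace R S i1) (gabor_subspace R S i2) ^+ 2
        = K%:R * (N%:R - K%:R) / (N%:R - 1)].
Proof.
move=> N_ge2 [S_neq0 cardS diffS].
(* For [d != 0], pairs with difference [d] have distinct entries. *)
have pairsS d : d != 0 -> #|difference_pairs S d| = lam.
  move=> d_neq0; rewrite -(diffS d d_neq0); apply: eq_card => -[a b].
  rewrite !inE /=; case: (eqVneq (a - b) d) => [abd|]; rewrite ?andbF // !andbT.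
  suff -> : a != b by rewrite andbT.
  by rewrite -subr_eq0 abd.
have chordalS i1 i2 : i1 != i2 ->
    chordal_dist (gabor_subspace R S i1) (gabor_subspace R S i2)
    = sqrtC (K%:R - lam%:R).
  by move=> neq; rewrite gabor_chordal_dist // cardS pairsS // subr_eq0 eq_sym.
split.
- have K_gt0 : (0 < K)%N by rewrite -cardS card_gt0.
  exists K%:R, K%:R; split; rewrite ?ltr0n // => x.
  by rewrite gabor_tight_frame // cardS rmorph_nat lexx.
- split=> [i j|i j k l neq_ij neq_kl]; first by rewrite !rank_gabor_subspace.
  by rewrite !chordalS.
move=> i1 i2 neq; rewrite chordalS // sqrtCK.
have N1 : N%:R - 1 != 0 :> R[i] by rewrite subr_eq0 pnatr_eq1 gtn_eqF.
apply/eqP; rewrite -(can2_eq (mulfK N1) (mulfVK N1)); apply/eqP.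
have := difference_count pairsS; rewrite cardS card_ord (Zp_cast N_ge2).
move=> /(congr1 (fun n => n%:R : R[i])).
rewrite natrD natrM natrX natrB ?(ltnW N_ge2) // => count; ring: (esym count).
Qed.
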